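(* Let $(X,\cdot)$ and $(A,* )$ be two racks, let $\Phi:A\to\operatorname{Conj}(\operatorname{Aut}(X))$, $a\mapsto\Phi_a\in\operatorname{Aut}(X)$, be a rack homomorphism, and let $(X,A,\Phi,B)$ be a relative Rota--Baxter rack. Set $$x\circ y:=(x\Phi_{B(y)})\cdot y\in X,\qquad x,y\in X.$$ (i) If $\operatorname{Im}\Phi=\{\mathrm{id}\}$, then $B(x)*B(y)=B(x\cdot y)$ for all $x,y\in X$. Hence $B:X\to A$ is a homomorphism and $x\circ y=x\cdot y$ for all $x,y\in X$. (ii) If $\operatorname{Im}\Phi\neq\{\mathrm{id}\}$ and for any $x,y,z\in X$ $$\big((x\Phi_{B(y)})\Phi_{B(z)}\big)\cdot z=\Big(\big(x\Phi_{B(z)}\big)\Phi_{B((y\Phi_{B(z)})\cdot z)}\Big)\cdot\Big(z\,\Phi_{B((y\Phi_{B(z)})\cdot z)}\Big),$$ then $(X,\circ)$ is a rack. Moreover, if $(X,A,\Phi,B)$ is a relative Rota--Baxter quandle and $x\Phi_{B(x)}=x$ for any $x\in X$, then $(X,\circ)$ is a quandle.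
   Context: A rack is a non-empty set $Q$ with a binary operation $*$ such that (Q2) for all $x,y\in Q$ there is a unique $z\in Q$ with $x=z*y$, and (Q3) $(x*y)*z=(x*z)*(y*z)$ for all $x,y,z\in Q$. A quandle is a rack satisfying also (Q1) $x*x=x$ for all $x\in Q$. A rack homomorphism is a map preserving the operations. $\operatorname{Aut}(X)$ is the group of rack automorphisms of $X$, acting on the right: $x\varphi$ is the image of $x$ under $\varphi$, and $x(\varphi\psi)=(x\varphi)\psi$. For a group $G$, $\operatorname{Conj}(G)$ is the quandle on the set $G$ with operation $a*b=b^{-1}ab$. Given racks $(X,\cdot)$, $(A,* )$ and a rack homomorphism $\Phi:A\to\operatorname{Conj}(\operatorname{Aut}(X))$, $a\mapsto\Phi_a$, a relative Rota--Baxter operator on $(X,\cdot)$ with respect to $(A,\Phi)$ is a map $B:X\to A$ such that $B(x)*B(y)=B\big((x\Phi_{B(y)})\cdot y\big)$ for all $x,y\in X$. The quadruple $(X,A,\Phi,B)$ is then called a relative Rota--Baxter rack; if $X$ and $A$ are quandles, it is called a relative Rota--Baxter quandle. *)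

(* Defs.v *)
From HB Require Import structures.
From mathcomp Require Import all_boot monoid.
From mathcomp Require Import boolp.

Set Implicit Arguments.
Unset Strict Implicit.
Unset Printing Implicit Defensive.

Record is_rack (Q : Type) (op : Q -> Q -> Q) : Prop := IsRack {
  rack_inhabited : inhabited Q;
  rack_divr : forall x y, exists! z, x = op z y;
  rack_distr : forall x y z, op (op x y) z = op (op x z) (op y z)
}.

Record is_quandle (Q : Type) (op : Q -> Q -> Q) : Prop := IsQuandle {
  quandle_is_rack : is_rack op;
  quandle_idem : forall x, op x x = x
}.

HB.mixin Record hasRack (Q : Type) := {
  rop : Q -> Q -> Q;
  ropP : is_rack rop
}.

#[short(type="rackType")]
HB.structure Definition Rack := {Q of hasRack Q}.

Notation "x \rhd y" := (rop x y) (at level 40, left associativity).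

Definition rack_hom (X Y : rackType) (f : X -> Y) : Prop :=
  {morph f : x y / x \rhd y}.

(* The group Conj is taken over is not required to be finite; [conjg a b] is
   [b^-1 * (a * b)]. *)
Definition Conj (G : groupType) : Type := G.

Lemma Conj_is_quandle (G : groupType) :
  @is_quandle (Conj G) (@conjg G).
Proof.
split; last by move=> x; rewrite /conjg mulKg.
split; first exact: (inhabits (1%g : G)).
- move=> x y; exists (conjg x y^-1%g); split; first by rewrite conjgKV.
  by move=> z ->; rewrite conjgK.
- by move=> x y z; rewrite conjJg.
Qed.

HB.instance Definition _ (G : groupType) :=
  hasRack.Build (Conj G) (quandle_is_rack (Conj_is_quandle G)).

Section Automorphisms.
Variable X : rackType.

Record rack_aut := RackAut {
  aut_fun :> X -> X;
  aut_bij : bijective aut_fun;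
  aut_hom : rack_hom aut_fun
}.

Lemma aut_eqP (f g : rack_aut) : aut_fun f =1 aut_fun g -> f = g.
Proof.
case: f g => [f fb fh] [g gb gh] /= /funext fg; subst g.
by rewrite (Prop_irrelevance fb gb) (Prop_irrelevance fh gh).
Qed.

Lemma aut_id_hom : rack_hom (id : X -> X). Proof. by []. Qed.

Definition aut_one : rack_aut := RackAut (@inv_bij X id (frefl _)) aut_id_hom.

Lemma aut_mul_hom (f g : rack_aut) : rack_hom (g \o f).
Proof. by move=> x y /=; rewrite !aut_hom. Qed.

(* Automorphisms act on the right: [f x] is x f, and f * g is f followed by
   g, so that [(f * g)%g x = g (f x)]. *)
Definition aut_mul (f g : rack_aut) : rack_aut :=
  RackAut (bij_comp (aut_bij g) (aut_bij f)) (@aut_mul_hom f g).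

Lemma aut_inv_ex (f : rack_aut) : exists g : X -> X, cancel f g /\ cancel g f.
Proof. by case: (aut_bij f) => g fK gK; exists g. Qed.

Definition aut_inv_fun (f : rack_aut) : X -> X := sval (cid (aut_inv_ex f)).

Lemma aut_invK (f : rack_aut) : cancel f (aut_inv_fun f).
Proof. by rewrite /aut_inv_fun; case: cid => g []. Qed.

Lemma aut_invVK (f : rack_aut) : cancel (aut_inv_fun f) f.
Proof. by rewrite /aut_inv_fun; case: cid => g []. Qed.

Lemma aut_inv_bij (f : rack_aut) : bijective (aut_inv_fun f).
Proof. exact: Bijective (@aut_invVK f) (@aut_invK f). Qed.

Lemma aut_inv_hom (f : rack_aut) : rack_hom (aut_inv_fun f).
Proof.
by move=> x y; apply: (can_inj (@aut_invK f)); rewrite aut_hom !aut_invVK.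
Qed.

Definition aut_inv (f : rack_aut) : rack_aut :=
  RackAut (aut_inv_bij f) (@aut_inv_hom f).

Lemma aut_mulA : associative aut_mul.
Proof. by move=> f g h; apply: aut_eqP. Qed.

Lemma aut_mul1 : left_id aut_one aut_mul.
Proof. by move=> f; apply: aut_eqP. Qed.

Lemma aut_mulr1 : right_id aut_one aut_mul.
Proof. by move=> f; apply: aut_eqP. Qed.

Lemma aut_mulV : left_inverse aut_one aut_inv aut_mul.
Proof. by move=> f; apply: aut_eqP => x; apply: aut_invVK. Qed.

Lemma aut_mulrV : right_inverse aut_one aut_inv aut_mul.
Proof. by move=> f; apply: aut_eqP => x; apply: aut_invK. Qed.

HB.instance Definition _ := gen_eqMixin rack_aut.
HB.instance Definition _ := gen_choiceMixin rack_aut.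
HB.instance Definition _ :=
  isGroup.Build rack_aut aut_mulA aut_mul1 aut_mulr1 aut_mulV aut_mulrV.

End Automorphisms.

Section RelativeRotaBaxter.
Variables (X A : rackType) (Phi : A -> Conj (rack_aut X)) (B : X -> A).

(* x Phi_a, the image of x under the automorphism Phi_a *)
Definition act (x : X) (a : A) : X := (Phi a : rack_aut X) x.

Definition rel_RB_operator : Prop :=
  forall x y, B x \rhd B y = B (act x (B y) \rhd y).

Definition rel_RB_rack : Prop := rack_hom Phi /\ rel_RB_operator.

Definition rel_RB_quandle : Prop :=
  [/\ rel_RB_rack, is_quandle (@rop X) & is_quandle (@rop A)].

Definition rb_op (x y : X) : X := act x (B y) \rhd y.

End RelativeRotaBaxter.

(* Main.v *)
Require Import Defs.
From mathcomp Require Import all_boot monoid.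
From mathcomp Require Import boolp classical_sets.

Set Implicit Arguments.
Unset Strict Implicit.
Unset Printing Implicit Defensive.

(** The operation [rb_op] sends [x] to [(x Phi_{B y}) \rhd y], so right
    [rb_op]-translation by [y] is the automorphism [Phi_{B y}] followed by
    right translation by [y].  Both are bijections, which gives unique right
    division.  For self-distributivity, push the automorphisms through the
    products and use self-distributivity of [X]; with [w = rb_op y z],
<<
  rb_op (rb_op x y) z = ((x Phi_{B y} Phi_{B z}) \rhd z) \rhd w
  rb_op (rb_op x z) w = ((x Phi_{B z} Phi_{B w}) \rhd (z Phi_{B w})) \rhd w
>>
    and the compatibility condition says exactly that the left factors of [w]
    agree.  If moreover [x Phi_{B x} = x], then [rb_op x x] is [x \rhd x], so
    idempotency is inherited from [X].  When [Phi] is trivial, [rb_op] is the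
    operation of [X], and the Rota-Baxter identity becomes the homomorphism
    identity for [B]. *)

Local Open Scope classical_set_scope.

Section RotaBaxterOperation.
Variables (X A : rackType) (Phi : A -> Conj (rack_aut X)) (B : X -> A).

Lemma actM (a : A) : {morph act Phi ^~ a : x y / x \rhd y}.
Proof. by move=> x y; apply: aut_hom. Qed.

(** Dividing by [y] in [X] and then applying the inverse of [Phi_{B y}] undoes
    right [rb_op]-translation by [y]; injectivity of [Phi_{B y}] carries the
    uniqueness of division over from [X]. *)
Lemma rb_op_divr (x y : X) : exists! z, x = rb_op Phi B z y.
Proof.
have [z [zP z_uniq]] := rack_divr (@ropP X) x y.
have [g fK gK] := aut_bij (Phi (B y) : rack_aut X).
exists (g z); split=> [|t /z_uniq ->]; last exact: fK.
by rewrite /rb_op /act gK.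
Qed.

(** Both sides are products with right factor [rb_op y z]; the hypothesis
    identifies their left factors. *)
Lemma rb_op_distr (x y z : X) :
    act Phi (act Phi x (B y)) (B z) \rhd z =
    act Phi (act Phi x (B z)) (B (act Phi y (B z) \rhd z))
      \rhd act Phi z (B (act Phi y (B z) \rhd z)) ->
  rb_op Phi B (rb_op Phi B x y) z =
  rb_op Phi B (rb_op Phi B x z) (rb_op Phi B y z).
Proof.
move=> compat.
by rewrite /rb_op !actM (rack_distr (@ropP X)) compat.
Qed.

Lemma rb_op_fixed (x y : X) :
  act Phi x (B y) = x -> rb_op Phi B x y = x \rhd y.
Proof. by rewrite /rb_op => ->. Qed.

End RotaBaxterOperation.

Theorem theorem3p6 (X A : rackType) (Phi : A -> Conj (rack_aut X)) (B : X -> A)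
    (hB : rel_RB_rack Phi B) :
  (range Phi = [set (1%g : rack_aut X)] ->
    [/\ forall x y : X, B x \rhd B y = B (x \rhd y),
        rack_hom B &
        forall x y : X, rb_op Phi B x y = x \rhd y])
  /\
  (range Phi <> [set (1%g : rack_aut X)] ->
    (forall x y z : X,
       act Phi (act Phi x (B y)) (B z) \rhd z =
       act Phi (act Phi x (B z)) (B (act Phi y (B z) \rhd z))
         \rhd act Phi z (B (act Phi y (B z) \rhd z))) ->
    is_rack (rb_op Phi B)
    /\ (rel_RB_quandle Phi B -> (forall x : X, act Phi x (B x) = x) ->
        is_quandle (rb_op Phi B))).
Proof.
case: hB => _ BP; split=> [imPhi | _ compat].
  have act1 x a : act Phi x a = x.
    have : range Phi (Phi a) by exists a.
    by rewrite imPhi /act => ->.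
  have opE x y : rb_op Phi B x y = x \rhd y by exact: rb_op_fixed.
  have BM x y : B x \rhd B y = B (x \rhd y) by rewrite BP act1.
  by split=> // x y; rewrite BM.
have rack_rb : is_rack (rb_op Phi B).
  split; [exact: rack_inhabited (@ropP X) | exact: rb_op_divr |].
  by move=> x y z; apply: rb_op_distr.
split=> // -[_ quandleX _] fixB; split=> // x.
by rewrite rb_op_fixed // (quandle_idem quandleX).
Qed.
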